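(* Let $E$ be a Hausdorff topological vector space over $\mathbb{R}$ and let $A$ be a topologically independent subset of (the additive topological group of) $E$. Then $\langle A\rangle$ is the Tychonoff direct sum $\bigoplus_{a\in A}\langle a\rangle$ if and only if the topology of the linear span $\langle A\rangle_{\mathbb{R}}$ (with the subspace topology from $E$) is weak.
   Context: $\langle A\rangle$ is the additive subgroup generated by $A$ and $\langle A\rangle_{\mathbb{R}}$ its real linear span, both with subspace topology. A subset $A$ of an abelian topological group $G$ (neutral element $0$) is topologically independent if $0\notin A$ and for every neighborhood $W$ of $0$ there is a neighborhood $U$ of $0$ such that for every finite $F\subseteq A$ and every family of integers $\{z_a: a\in F\}$, the condition $\sum_{a\in F}z_a a\in U$ implies $z_a a\in W$ for all $a\in F$. The Tychonoff direct sum $\bigoplus_{a\in A}\langle a\rangle$ is the direct sum of the groups $\langle a\rangle$ (subspace topology) with the topology induced from the product $\prod_{a\in A}\langle a\rangle$; ''$\langle A\rangle$ is the Tychonoff direct sum'' means the map $(g_a)\mapsto\sum_a g_a$ is an isomorphism of topological groups from $\bigoplus_{a\in A}\langle a\rangle$ onto $\langle A\rangle$. The topology of a topological vector space $X$ is weak if it coincides with the coarsest topology making all continuous linear functionals on $X$ continuous. *)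

(* Defs.v *)
From HB Require Import structures.
From mathcomp Require Import all_boot all_order all_algebra.
From mathcomp Require Import all_classical all_reals all_analysis.
Set Implicit Arguments. Unset Strict Implicit. Unset Printing Implicit Defensive.
Import Order.TTheory GRing.Theory Num.Theory numFieldNormedType.Exports.
Local Open Scope classical_set_scope.
Local Open Scope ring_scope.

Section Defs.
Context (R : realType) (E : topologicalLmodType R).

Definition top_independent (A : set E) : Prop :=
  ~ A 0 /\
  forall W : set E, nbhs (0 : E) W ->
    exists2 U : set E, nbhs (0 : E) U &
      forall (F : seq E) (z : E -> int),
        uniq F -> (forall a, a \in F -> A a) ->
        U (\sum_(a <- F) a *~ z a) -> forall a, a \in F -> W (a *~ z a).

Definition gen_subgroup (A : set E) : set E :=
  [set x | exists (F : seq E) (z : E -> int),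
      (forall a, a \in F -> A a) /\ x = \sum_(a <- F) a *~ z a].

Definition lin_span (A : set E) : set E :=
  [set x | exists (F : seq E) (c : E -> R),
      (forall a, a \in F -> A a) /\ x = \sum_(a <- F) c a *: a].

(* The direct sum (+)_{a in A} <a>, realised as the set of finitely supported
   families g with g a \in <a> for a \in A, and g x = 0 outside A, inside the
   product space E^E with its product (Tychonoff) topology; since coordinates
   outside A are constantly 0, its subspace topology is that induced from
   prod_{a in A} <a>. *)
Definition dsum (A : set E) : set {ptws E -> E} :=
  [set g | (forall x, ~ A x -> g x = 0) /\
           (forall a, A a -> exists n : int, g a = a *~ n) /\
           finite_set [set a | g a != 0]].

Definition dsum_map (A : set E) (g : {ptws E -> E}) : E := \sum_(a \in A) g a.

Definition is_tychonoff_dsum (A : set E) : Prop :=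
  set_bij (dsum A) (gen_subgroup A) (dsum_map A) /\
  (forall g h, dsum A g -> dsum A h ->
     dsum_map A (fun x => g x + h x) = dsum_map A g + dsum_map A h) /\
  {within dsum A, continuous (dsum_map A)} /\
  exists2 inv : E -> {ptws E -> E},
    (forall x, gen_subgroup A x -> dsum A (inv x) /\ dsum_map A (inv x) = x) &
    {within gen_subgroup A, continuous inv}.

Definition cont_lin_functional (L : set E) (f : E -> R) : Prop :=
  (forall (r : R) (x y : E), L x -> L y -> f (r *: x + y) = r * f x + f y) /\
  {within L, continuous f}.

(* neighbourhoods of x in the weak topology of the subspace L, i.e. the
   coarsest topology on L making all continuous linear functionals on L
   continuous *)
Definition weak_nbhs (L : set E) (x : E) (U : set E) : Prop :=
  exists (fs : seq (E -> R)) (eps : R),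
    (forall f, f \in fs -> cont_lin_functional L f) /\ 0 < eps /\
    [set y | L y /\ forall f, f \in fs -> `|f y - f x| < eps] `<=` U.

Definition topology_is_weak (L : set E) : Prop :=
  forall x, L x -> forall U : set E, within L (nbhs x) U <-> weak_nbhs L x U.

End Defs.

(* Main.v *)
Require Import Defs.
From HB Require Import structures.
From mathcomp Require Import all_boot all_order all_algebra.
From mathcomp Require Import all_classical all_reals all_analysis.
From mathcomp Require Import lra ring.
Set Implicit Arguments. Unset Strict Implicit. Unset Printing Implicit Defensive.
Import Order.TTheory GRing.Theory Num.Theory numFieldNormedType.Exports.
Local Open Scope classical_set_scope.
Local Open Scope ring_scope.

(* Given topological independence, summation is always a bijection of the direct
   sum onto <A> with continuous inverse, so everything hinges on the continuity
   of summation.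
   If the span is weak, a continuous functional f vanishes outside a finite part
   of A: otherwise, rounding multiples of a real linear relation to integers
   (Dirichlet) gives integer combinations that are small for the finitely many
   functionals defining a neighbourhood, yet have a component on which f is
   large. Hence a basic neighbourhood restricts only finitely many coordinates.
   Conversely, if summation is continuous, each neighbourhood U contains the
   group, hence up to an arbitrarily small error the span, generated by A
   without some finite set F. Simultaneous Dirichlet approximation on F with a
   bounded denominator shows that the real coordinates along A are continuous
   functionals, and the coordinates on F control membership in U. *)

(** * Diophantine approximation *)

(** Pigeonhole: the fractional parts of [i%:R * x] for [i] from 0 to [M] lie in [M] cells of width
    [1/M], and the difference of two indices sharing a cell serves as [n]. *)
Lemma dirichlet_approx (R : realType) (x : R) (M : nat) : (0 < M)%N ->
  exists n : nat, exists2 z : int, (0 < n <= M)%N & `|n%:R * x - z%:~R| < M%:R^-1.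
Proof.
move=> M0.
have MR : 0 < M%:R :> R by rewrite ltr0n.
pose fr (i : nat) : R := i%:R * x - (Num.floor (i%:R * x))%:~R.
have fr0 i : 0 <= fr i by rewrite subr_ge0 floor_le.
have fr1 i : fr i < 1 by rewrite ltrBlDl -intrD1 floorD1_gt.
have cell i : (Num.truncn (M%:R * fr i) < M)%N.
  by rewrite truncn_lt_nat ?gtr_pMr// mulr_ge0.
pose g (i : 'I_M.+1) : 'I_M := Ordinal (cell i).
have /injectivePn[i [j ij gij]] : ~~ injectiveb g.
  by apply/negP => /injectiveP /leq_card; rewrite !card_ord ltnn.
wlog ltij : i j ij gij / (i < j)%N.
  move=> H; have := ij; rewrite neq_ltn => /orP[|] h; first exact: (H i j).
  by apply: (H j i) => //; rewrite eq_sym.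
exists (j - i)%N, (Num.floor (j%:R * x) - Num.floor (i%:R * x)).
  by rewrite subn_gt0 ltij/= (leq_trans (leq_subr _ _))// -ltnS ltn_ord.
have -> : (j - i)%:R * x - (Num.floor (j%:R * x) - Num.floor (i%:R * x))%:~R
   = fr j - fr i.
  by rewrite natrB ?(ltnW ltij)// rmorphB/= /fr; ring.
rewrite -(ltr_pM2l MR) divff ?gt_eqF//.
rewrite -[in X in X * _](ger0_norm (ltW MR)) -normrM mulrBr.
have /= /(congr1 val)/= gij' := gij.
have ti := truncn_itv (mulr_ge0 (ltW MR) (fr0 i)).
have tj := truncn_itv (mulr_ge0 (ltW MR) (fr0 j)).
rewrite gij' in ti.
move: ti tj => /andP[]; rewrite -natr1 => ? ? /andP[? ?].
rewrite ltr_norml; apply/andP; split; lra.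
Qed.

(** The bound [N] is chosen before [c], so denominators are bounded uniformly in the numbers
    approximated; [coord_bounded] relies on this. *)
Lemma simultaneous_approx (R : realType) (T : eqType) (F : seq T) (e : R) :
  0 < e -> exists N : nat, forall c : T -> R, exists n : nat,
    exists2 z : T -> int, (0 < n <= N)%N &
      forall b, b \in F -> `|n%:R * c b - (z b)%:~R| < e.
Proof.
elim: F e => [|a F IH] e e0; first by exists 1%N => c; exists 1%N, (fun=> 0).
pose M := (Num.truncn e^-1).+1.
have MR : 0 < M%:R :> R by rewrite ltr0n.
have eM : M%:R^-1 < e.
  by rewrite invf_plt ?posrE// truncnS_gt.
(* The tail needs precision [e / M], because its error is multiplied by some [m <= M] when [a] is
   treated. *)
have [N HN] := IH _ (divr_gt0 e0 MR).
exists (M * N)%N => c.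
have [n [z /andP[n0 nN] hz]] := HN c.
have [m [w /andP[m0 mM] hw]] := dirichlet_approx (n%:R * c a) (isT : (0 < M)%N).
exists (m * n)%N, (fun b => if b == a then w else m%:Z * z b).
  by rewrite muln_gt0 m0 n0 leq_mul.
move=> b; rewrite inE natrM -mulrA; case: eqVneq => [->/= _|_ /= bF].
  exact: lt_trans eM.
rewrite intrM -mulrBr normrM ger0_norm ?ler0n//.
apply: (@le_lt_trans _ _ (M%:R * `|n%:R * c b - (z b)%:~R|)).
  by rewrite ler_wpM2r// ler_nat.
by rewrite mulrC -ltr_pdivlMr// hz.
Qed.

(** * Neighbourhoods of zero and linear spans *)

Section TopologicalVectorSpace.
Context (R : realType) (E : topologicalLmodType R).
Implicit Types (U V W : set E) (A B : set E).

Lemma nbhs0_add U : nbhs (0 : E) U ->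
  exists2 V : set E, nbhs (0 : E) V & forall x y, V x -> V y -> U (x + y).
Proof.
move=> U0; have := @add_continuous E (0, 0) U; rewrite /= addr0 => /(_ U0).
move=> [[V1 V2]] /= [V10 V20] sub.
exists (V1 `&` V2); first exact: filterI.
by move=> x y [V1x _] [_ V2y]; apply: (sub (x, y)).
Qed.

Lemma nbhs_shift (x : E) U : nbhs (0 : E) [set v | U (x + v)] <-> nbhs x U.
Proof.
have shift (a b : E) V : nbhs (a + b) V -> nbhs b [set v | V (a + v)].
  move=> Vx; have := @add_continuous E (a, b) V => /(_ Vx).
  move=> [[V1 V2]] /= [V10 V20] sub.
  apply: filterS V20 => v V2v.
  by apply: (sub (a, v)); split => //=; exact: nbhs_singleton.
split=> [U0|Ux]; last by apply: shift; rewrite addr0.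
have := shift (- x) x [set v | U (x + v)].
rewrite addNr => /(_ U0); apply: filterS => v /=.
by rewrite addrA subrr add0r.
Qed.

Lemma nbhs0_scale (r : R) U : nbhs (0 : E) U -> nbhs (0 : E) [set v | U (r *: v)].
Proof.
move=> U0; have := @scale_continuous R E (r, 0) U; rewrite /= scaler0 => /(_ U0).
move=> [[V1 V2]] /= [V10 V20] sub.
apply: filterS V20 => v V2v.
by apply: (sub (r, v)); split => //=; exact: nbhs_singleton.
Qed.

Lemma nbhs0_line (a : E) U : nbhs (0 : E) U ->
  exists2 e : R, 0 < e & forall t, `|t| < e -> U (t *: a).
Proof.
move=> U0; have := @scale_continuous R E (0, a) U; rewrite /= scale0r => /(_ U0).
move=> [[V1 V2]] /= [V10 V20] sub.
have /nbhs_ballP[e /= e0 eV] := V10; exists e => // t te.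
apply: (sub (t, a)); split => /=; last exact: nbhs_singleton.
by apply: eV; rewrite -ball_normE/= sub0r normrN.
Qed.

Definition balanced U := forall (t : R) v, `|t| <= 1 -> U v -> U (t *: v).

(** Continuity of scaling at [(0, 0)] puts in [U] all products [t *: w] with [t] small and [w] in
    some neighbourhood; the set of these products is balanced. *)
Lemma nbhs0_balanced U : nbhs (0 : E) U ->
  exists V : set E, [/\ nbhs (0 : E) V, V `<=` U & balanced V].
Proof.
move=> U0; have := @scale_continuous R E (0, 0) U; rewrite /= scale0r => /(_ U0).
move=> [[V1 V2]] /= [V10 V20] sub.
have /nbhs_ballP[e /= e0 eV] := V10.
exists [set v | exists (t : R) w, [/\ `|t| < e, V2 w & v = t *: w]]; split.
- have e20 : e / 2 != 0 by rewrite gt_eqF// divr_gt0.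
  apply: filterS (nbhs0_scale (e / 2)^-1 V20) => v V2v.
  exists (e / 2), ((e / 2)^-1 *: v); split => //.
    by rewrite gtr0_norm ?divr_gt0// ltr_pdivrMr// ltr_pMr// ltr1n.
  by rewrite scalerA divff// scale1r.
- move=> _ [t [w [te V2w ->]]]; apply: (sub (t, w)); split => //=.
  by apply: eV; rewrite -ball_normE/= sub0r normrN.
- move=> s _ s1 [t [w [te V2w ->]]]; exists (s * t), w; split => //.
    by rewrite normrM (le_lt_trans _ te)// ler_piMl.
  by rewrite scalerA.
Qed.

Lemma balanced_nbhs0_add U : nbhs (0 : E) U ->
  exists V : set E, [/\ nbhs (0 : E) V, V `<=` U, balanced V &
    forall x y, V x -> V y -> U (x + y)].
Proof.
move=> U0; have [V V0 VU] := nbhs0_add U0.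
have [W [W0 WV Wb]] := nbhs0_balanced (filterI V0 U0).
exists W; split => //; first by move=> x /WV[].
by move=> x y /WV[Vx _] /WV[Vy _]; exact: VU.
Qed.

(** Serves to absorb the errors made when real coefficients on a finite list are rounded. *)
Lemma nbhs0_small_comb (F : seq E) U : nbhs (0 : E) U ->
  exists2 e : R, 0 < e & forall c : E -> R,
    (forall a, a \in F -> `|c a| < e) -> U (\sum_(a <- F) c a *: a).
Proof.
elim: F U => [|a F IH] U U0.
  by exists 1 => // c _; rewrite big_nil; exact: nbhs_singleton.
have [V V0 VU] := nbhs0_add U0.
have [e e0 He] := IH _ V0.
have [d d0 Hd] := nbhs0_line a V0.
exists (Num.min d e); first by rewrite lt_min d0.
move=> c Hc; rewrite big_cons; apply: VU.
  by apply: Hd; have := Hc a (mem_head _ _); rewrite lt_min => /andP[].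
by apply: He => b bF; have := Hc b; rewrite inE bF orbT lt_min => /(_ isT)/andP[].
Qed.

Lemma hausdorff_nbhs0 (a : E) : hausdorff_space E -> a != 0 ->
  exists2 W : set E, nbhs (0 : E) W & ~ W a.
Proof.
move=> /hausdorff_accessible T1; rewrite eq_sym => /T1[W [oW W0 Wa]].
exists W; first by apply: open_nbhs_nbhs; split => //; exact: set_mem.
by move: Wa; rewrite inE.
Qed.

Lemma lin_spanS A B : A `<=` B -> lin_span A `<=` lin_span B.
Proof. by move=> AB x [F [c [FA ->]]]; exists F, c; split => // a /FA/AB. Qed.

Lemma lin_span0 A : lin_span A 0.
Proof. by exists [::], (fun=> 0); rewrite big_nil; split. Qed.

Lemma lin_spanZ A (r : R) x : lin_span A x -> lin_span A (r *: x).
Proof.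
move=> [F [c [FA ->]]]; exists F, (fun a => r * c a); split => //.
by rewrite scaler_sumr; apply: eq_bigr => a _; rewrite scalerA.
Qed.

(** Repeated entries are merged by multiplying each coefficient by the multiplicity of its
    vector. *)
Lemma lin_span_uniq A x : lin_span A x -> exists (F : seq E) (c : E -> R),
  [/\ uniq F, forall a, a \in F -> A a & x = \sum_(a <- F) c a *: a].
Proof.
move=> [F [c [FA ->]]].
exists (undup F), (fun a => c a *+ count_mem a F); split; first exact: undup_uniq.
  by move=> a; rewrite mem_undup; exact: FA.
rewrite -big_undup_iterop_count/=; apply: eq_bigr => a _.
by rewrite -scalerMnl; case: (count_mem a F).
Qed.

Lemma lin_span_addgen A (r : R) a x : A a -> lin_span A x -> lin_span A (r *: a + x).
Proof.
move=> Aa /lin_span_uniq[F [c [Fu FA ->]]].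
have [aF|aF] := boolP (a \in F).
  exists F, (fun b => if b == a then r + c a else c b); split => //.
  rewrite !(bigD1_seq a aF Fu)/= eqxx scalerDl addrA; congr (_ + _).
  by apply: eq_bigr => b /negbTE ->.
exists (a :: F), (fun b => if b == a then r else c b); split.
  by move=> b; rewrite inE => /orP[/eqP->|/FA].
rewrite big_cons eqxx; congr (_ + _); rewrite !big_seq; apply: eq_bigr => b bF.
by case: eqVneq bF aF => // -> ->.
Qed.

Lemma lin_span_comb A (F : seq E) (c : E -> R) x :
  (forall a, a \in F -> A a) -> lin_span A x ->
  lin_span A (\sum_(a <- F) c a *: a + x).
Proof.
elim: F => [|a F IH] FA Ax; first by rewrite big_nil add0r.
rewrite big_cons -addrA; apply: lin_span_addgen; first exact/FA/mem_head.
by apply: IH => // b bF; apply: FA; rewrite inE bF orbT.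
Qed.

Lemma lin_spanD A x y : lin_span A x -> lin_span A y -> lin_span A (x + y).
Proof. by move=> [F [c [FA ->]]] Ay; exact: lin_span_comb. Qed.

Lemma lin_spanB A x y : lin_span A x -> lin_span A y -> lin_span A (x - y).
Proof.
by move=> Ax Ay; apply: lin_spanD => //; rewrite -scaleN1r; exact: lin_spanZ.
Qed.

Lemma lin_span_gen A a : A a -> lin_span A a.
Proof.
by move=> Aa; rewrite -[a]addr0 -[a in a + _]scale1r;
  apply: lin_span_addgen => //; exact: lin_span0.
Qed.

(** Existence only: uniqueness of the component along [a] comes from [lin_span_indep]. *)
Lemma lin_spanD1 A a x : lin_span A x ->
  exists r : R, lin_span (A `\ a) (x - r *: a).
Proof.
move=> /lin_span_uniq[F [c [Fu FA ->]]].
have [aF|aF] := boolP (a \in F).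
  exists (c a); rewrite (bigD1_seq a aF Fu)/= addrAC subrr add0r -big_filter.
  exists [seq b <- F | b != a], c; split => // b.
  by rewrite mem_filter => /andP[/eqP ba /FA].
exists 0; rewrite scale0r subr0; exists F, c; split => // b bF.
by split; [exact: FA | move=> /= ba; move: aF; rewrite -ba bF].
Qed.

Lemma lin_spanDseq A (F : seq E) x : uniq F -> lin_span A x ->
  exists c : E -> R, lin_span (A `\` [set` F]) (x - \sum_(a <- F) c a *: a).
Proof.
move=> + Ax; elim: F => [_|a F IH /= /andP[aF /IH[c cx]]].
  by exists (fun=> 0); rewrite big_nil subr0; apply: lin_spanS Ax => b Ab; split.
have [r rx] := lin_spanD1 a cx.
exists (fun b => if b == a then r else c b); rewrite big_cons eqxx.
have -> : \sum_(b <- F) (if b == a then r else c b) *: b = \sum_(b <- F) c b *: b.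
  rewrite !big_seq; apply: eq_bigr => b bF.
  by case: eqVneq bF aF => // -> ->.
rewrite opprD (addrC (- _)) addrA.
by apply: lin_spanS rx => b [[Ab bF] ba]; split => //=; rewrite inE => /orP[/eqP|].
Qed.

End TopologicalVectorSpace.

(** * The topology of pointwise convergence *)

(** This topology is the supremum of those pulled back along the evaluations, so convergence is
    decided coordinatewise. *)
Lemma ptws_cvg (I : choiceType) (T : topologicalType)
    (F : set_system {ptws I -> T}) (f : {ptws I -> T}) : Filter F ->
  (forall i, (fun g : {ptws I -> T} => g i) @ F --> f i) -> F --> f.
Proof.
move=> FF Ff; apply/cvg_sup => i U [V] [[W] oW <-] Wfi WU.
by apply: (filterS WU); apply: (Ff i); apply: open_nbhs_nbhs.
Qed.

(* The sets {g | g = f on F}, F finite, form a filter base converging pointwise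
   to f, hence each neighbourhood of f contains one of them. *)
Lemma nbhs_ptws (I : choiceType) (T : topologicalType) (f : {ptws I -> T})
    (U : set {ptws I -> T}) : nbhs f U ->
  exists F : seq I, forall g : {ptws I -> T},
    (forall i, i \in F -> g i = f i) -> U g.
Proof.
pose G : set_system {ptws I -> T} := [set V | exists F : seq I,
  forall g : {ptws I -> T}, (forall i, i \in F -> g i = f i) -> V g].
have FG : Filter G.
  split; first by exists [::].
    move=> P Q [F FP] [F' FQ]; exists (F ++ F') => g gf; split.
      by apply: FP => i iF; apply: gf; rewrite mem_cat iF.
    by apply: FQ => i iF; apply: gf; rewrite mem_cat iF orbT.
  by move=> P Q PQ [F FP]; exists F => g /FP/PQ.
apply: (@ptws_cvg I T G f) => i W Wfi.
by exists [:: i] => g /(_ i (mem_head _ _)) /= ->; exact: nbhs_singleton.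
Qed.

(** * The direct sum and its summation map *)

Section DirectSum.
Context (R : realType) (E : topologicalLmodType R).
Implicit Types (A B : set E) (g h : {ptws E -> E}).

Lemma dsum_supp A g : dsum A g ->
  exists F : seq E, [/\ uniq F, forall a, a \in F -> A a &
    forall a, a \notin F -> g a = 0].
Proof.
move=> [g0 [gZ /finite_seqP[F gF]]]; exists (undup F).
have FE a : (a \in undup F) = (g a != 0).
  by rewrite mem_undup; apply/idP/idP => /=; have /= := congr1 (@^~ a) gF;
    move=> ->.
split; first exact: undup_uniq.
- move=> a; rewrite FE => ga; apply: contrapT => /g0 ga0.
  by rewrite ga0 eqxx in ga.
- by move=> a; rewrite FE negbK => /eqP.
Qed.

(** [F] may exceed the support of [g], so that several families can be summed over a common list. *)
Lemma dsum_map_seq A g (F : seq E) : dsum A g -> uniq F ->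
  (forall a, a \notin F -> g a = 0) -> dsum_map A g = \sum_(a <- F) g a.
Proof.
move=> [g0 _] Fu gF; rewrite /dsum_map fsbig_supp; apply: fsbig_fwiden => //.
  move=> a [_ /= ga]; apply: contrapT => /negP /gF; exact: ga.
move=> a [_ /= na]; apply: contrapT => ga; apply: na; split => //.
by apply: contrapT => /g0.
Qed.

Lemma dsumD A g h : dsum A g -> dsum A h -> dsum A (fun x => g x + h x).
Proof.
move=> [g0 [gZ gfin]] [h0 [hZ hfin]]; split.
  by move=> x Ax; rewrite g0// h0// addr0.
split; first by move=> a Aa; have [[n ->] [m ->]] := (gZ _ Aa, hZ _ Aa);
  exists (n + m); rewrite mulrzDr.
apply: (@sub_finite_set _ _ ([set a | g a != 0] `|` [set a | h a != 0])).
  move=> a /=; have [->|] := eqVneq (g a) 0; last by left.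
  by rewrite add0r; right.
by rewrite finite_setU.
Qed.

Lemma dsumN A g : dsum A g -> dsum A (fun x => - g x).
Proof.
move=> [g0 [gZ gfin]]; split; first by move=> x Ax; rewrite g0// oppr0.
split; first by move=> a Aa; have [n ->] := gZ _ Aa; exists (- n); rewrite mulrNz.
by apply: sub_finite_set gfin => a /=; rewrite oppr_eq0.
Qed.

Lemma dsum_mapD A g h : dsum A g -> dsum A h ->
  dsum_map A (fun x => g x + h x) = dsum_map A g + dsum_map A h.
Proof.
move=> Ag Ah; have [F [_ _ gF]] := dsum_supp Ag.
have [F' [_ _ hF]] := dsum_supp Ah.
have Fu := undup_uniq (F ++ F').
have nF a : a \notin undup (F ++ F') -> g a = 0 /\ h a = 0.
  by rewrite mem_undup mem_cat negb_or => /andP[/gF-> /hF->].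
rewrite (dsum_map_seq (dsumD Ag Ah) Fu).
  rewrite (dsum_map_seq Ag Fu) ?(dsum_map_seq Ah Fu) ?big_split//.
    by move=> a /nF[].
  by move=> a /nF[].
by move=> a /nF[-> ->]; rewrite addr0.
Qed.

Lemma dsum_mapN A g : dsum A g -> dsum_map A (fun x => - g x) = - dsum_map A g.
Proof.
move=> Ag; have [F [Fu _ gF]] := dsum_supp Ag.
rewrite (dsum_map_seq Ag Fu)// (dsum_map_seq (dsumN Ag) Fu) ?sumrN//.
by move=> a /gF ->; rewrite oppr0.
Qed.

Lemma dsumB A g h : dsum A g -> dsum A h -> dsum A (fun x => g x - h x).
Proof. by move=> Ag Ah; exact: (dsumD Ag (dsumN Ah)). Qed.

Lemma dsum_mapB A g h : dsum A g -> dsum A h ->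
  dsum_map A (fun x => g x - h x) = dsum_map A g - dsum_map A h.
Proof.
move=> Ag Ah; rewrite -(dsum_mapN Ah).
by rewrite -(dsum_mapD Ag (dsumN Ah)).
Qed.

Lemma dsum0 A : dsum A (fun=> 0).
Proof.
split => //; split; first by move=> a _; exists 0; rewrite mulr0z.
by rewrite (_ : [set _ | _] = set0)//; apply/seteqP; split => // a /=; rewrite eqxx.
Qed.

Lemma dsum_map0 A : dsum_map A (fun=> 0) = 0.
Proof. by rewrite /dsum_map fsbig1. Qed.

Lemma dsum_gen A g : dsum A g -> gen_subgroup A (dsum_map A g).
Proof.
move=> Ag; have [F [Fu FA gF]] := dsum_supp Ag; case: (Ag) => [_ [gZ _]].
have /choice[z Hz] a : exists n : int, A a -> g a = a *~ n.
  by have [/gZ[n]|] := pselect (A a); [exists n | exists 0].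
exists F, z; split => //; rewrite (dsum_map_seq Ag Fu gF) !big_seq.
by apply: eq_bigr => a /FA/Hz.
Qed.

(** One-point families are added up, so repeated entries of [F] accumulate in one coordinate. The
    last clause lets [cofinite_subgroup] prescribe zeros of [g]. *)
Lemma gen_dsum A (F : seq E) (z : E -> int) : (forall a, a \in F -> A a) ->
  exists g, [/\ dsum A g, dsum_map A g = \sum_(a <- F) a *~ z a &
    forall a, a \notin F -> g a = 0].
Proof.
elim: F => [_|a F IH FA].
  by exists (fun=> 0); split; [exact: dsum0 | rewrite dsum_map0 big_nil | ].
have [|g [Ag gF g0]] := IH; first by move=> b bF; apply: FA; rewrite inE bF orbT.
pose s : {ptws E -> E} := fun x => if x == a then a *~ z a else 0.
have As : dsum A s.
  have Aa : A a by exact/FA/mem_head.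
  split; first by move=> x; rewrite /s; case: (eqVneq x a) => [->|].
  split.
    move=> x Ax; rewrite /s; case: eqVneq => [->|_]; first by exists (z a).
    by exists 0; rewrite mulr0z.
  apply: (@sub_finite_set _ _ [set a]) => // x /=.
  by rewrite /s; case: (eqVneq x a) => [->//|_]; rewrite eqxx.
exists (fun x => s x + g x); split; first exact: dsumD.
  rewrite (dsum_mapD As Ag) gF big_cons; congr (_ + _).
  rewrite (@dsum_map_seq A s [:: a] As)//.
    by rewrite big_seq1 /s eqxx.
  by move=> b; rewrite inE /s => /negbTE ->.
move=> b; rewrite inE negb_or => /andP[/negbTE ba /g0 ->].
by rewrite /s ba addr0.
Qed.

(** Independence read as continuity at 0 of the inverse of summation, uniformly in the
    coordinates. *)
Lemma top_independent_dsum A (W : set E) : top_independent A -> nbhs (0 : E) W ->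
  exists2 U : set E, nbhs (0 : E) U &
    forall g, dsum A g -> U (dsum_map A g) -> forall a, W (g a).
Proof.
move=> [_ indA] W0; have [U U0 HU] := indA _ W0; exists U => // g Ag Ug a.
have [F [Fu FA gF]] := dsum_supp Ag; case: (Ag) => [_ [gZ _]].
have [aF|/gF ->] := boolP (a \in F); last exact: nbhs_singleton.
have /choice[z Hz] b : exists n : int, A b -> g b = b *~ n.
  by have [/gZ[n]|] := pselect (A b); [exists n | exists 0].
rewrite Hz; last exact: FA.
apply: (HU F z) => //; rewrite big_seq.
rewrite (eq_bigr g) => [|b /FA/Hz//]; rewrite -big_seq.
by rewrite -(dsum_map_seq Ag Fu gF).
Qed.

Lemma is_tychonoff_dsum_continuous A : hausdorff_space E -> top_independent A ->
  {within dsum A, continuous (dsum_map A)} -> is_tychonoff_dsum A.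
Proof.
move=> hE indA ctsA.
(* A non-zero coordinate avoids some [W], whereas independence forces every coordinate of a family
   with sum 0 into [W]. *)
have dsum_map_ker g : dsum A g -> dsum_map A g = 0 -> forall a, g a = 0.
  move=> Ag g0 a; apply/eqP/negPn/negP => /(hausdorff_nbhs0 hE)[W W0]; apply.
  have [U U0] := top_independent_dsum indA W0; apply => //.
  by rewrite g0; exact: nbhs_singleton.
have dsum_map_inj g h : dsum A g -> dsum A h ->
    dsum_map A g = dsum_map A h -> g = h.
  move=> Ag Ah gh; apply/funext => a; apply/eqP; rewrite -subr_eq0; apply/eqP.
  apply: (dsum_map_ker (fun x => g x - h x)); first exact: dsumB.
  by rewrite (dsum_mapB Ag Ah) gh subrr.
have /choice[inv invP] x : exists g, gen_subgroup A x ->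
    dsum A g /\ dsum_map A g = x.
  have [[F [z [FA ->]]]|] := pselect (gen_subgroup A x); last by exists (fun=> 0).
  by have [g [Ag gF _]] := gen_dsum z FA; exists g.
split; last split; last split => //.
- split; first by move=> g /dsum_gen.
    by move=> g h /set_mem Ag /set_mem Ah; exact: dsum_map_inj.
  by move=> x /invP[]; exists (inv x).
- by move=> g h Ag Ah; exact: dsum_mapD.
exists inv => //; apply/subspace_continuousP => x Ax.
(* One coordinate suffices; [top_independent_dsum] is applied to the difference of the two
   preimages. *)
apply: ptws_cvg => a W.
move=> /nbhs_shift /(top_independent_dsum indA)[U U0 HU].
have Ux : nbhs x [set y | U (y - x)].
  by apply/nbhs_shift; apply: filterS U0 => y /=; rewrite addrC addKr.
near_simpl; rewrite /within/=; apply: filterS Ux => y /= Uyx Ay.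
have [[Ix sx] [Iy sy]] := (invP _ Ax, invP _ Ay).
have := HU _ (dsumB Iy Ix); rewrite (dsum_mapB Iy Ix) sx sy => /(_ Uyx a).
by rewrite /= addrC subrK.
Qed.

End DirectSum.

(** * Finite linear relations and boxes in the product *)

(** The matrix of values, with rows indexed by [F] and columns by [fs], has more rows than columns;
    a non-zero row vector of its left kernel gives [c]. *)
Lemma linear_dependence (K : fieldType) (T : eqType) (F : seq T)
    (fs : seq (T -> K)) : uniq F -> (size fs < size F)%N ->
  exists c : T -> K, (exists2 a, a \in F & c a != 0) /\
    forall f, f \in fs -> \sum_(a <- F) c a * f a = 0.
Proof.
move=> Fu ltn.
pose M := \matrix_(j < size F, i < size fs)
  tnth (in_tuple fs) i (tnth (in_tuple F) j).
have /rowV0Pn[v /sub_kermxP vM v0] : kermx M != 0.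
  rewrite kermx_eq0 /row_free neq_ltn; apply/orP; left.
  by apply: leq_ltn_trans ltn; exact: rank_leq_col.
pose c a := oapp (fun j => v 0 j) 0 (insub (index a F)).
have cE j : c (tnth (in_tuple F) j) = v 0 j.
  by rewrite /c (tnth_nth (tnth (in_tuple F) j)) index_uniq//= valK.
exists c; split.
  have /rV0Pn[j vj] := v0.
  by exists (tnth (in_tuple F) j); [exact: mem_tnth | rewrite cE].
move=> f /(tnthP (in_tuple fs))[i ->].
have := congr1 (fun N : 'rV_(size fs) => N 0 i) vM; rewrite !mxE => vM0.
by apply: etrans vM0; rewrite big_tnth; apply: eq_bigr => j _; rewrite cE mxE.
Qed.

Lemma nbhs_ptws_box (I : choiceType) (T : topologicalType) (f : {ptws I -> T})
    (S : seq I) (N : I -> set T) : (forall i, nbhs (f i) (N i)) ->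
  nbhs f [set g : {ptws I -> T} | forall i, i \in S -> N i (g i)].
Proof.
move=> fN; elim: S => [|i S IH].
  by apply: filterS filterT => g _ i.
have Ni : nbhs f [set g : {ptws I -> T} | N i (g i)].
  exact: (@proj_continuous I (fun=> T) i f _ (fN i)).
apply: filterS (filterI Ni IH) => g [gi gS] j.
by rewrite inE => /orP[/eqP->|/gS].
Qed.

(** * Continuous functionals on the span, and consequences of weakness *)

Section Functionals.
Context (R : realType) (E : topologicalLmodType R).
Context (A : set E).
Implicit Types f g : E -> R.

Lemma functional0 f : cont_lin_functional (lin_span A) f -> f 0 = 0.
Proof.
move=> [flin _]; have := flin 1 _ _ (lin_span0 A) (lin_span0 A).
by rewrite scaler0 addr0 mul1r => /eqP; rewrite -subr_eq0 opprD addNKr oppr_eq0 => /eqP.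
Qed.

Lemma functional_comb f (F : seq E) (c : E -> R) :
  cont_lin_functional (lin_span A) f -> (forall a, a \in F -> A a) ->
  f (\sum_(a <- F) c a *: a) = \sum_(a <- F) c a * f a.
Proof.
move=> Af; elim: F => [|a F IH FA]; first by rewrite !big_nil (functional0 Af).
have FA' b : b \in F -> A b by move=> bF; apply: FA; rewrite inE bF orbT.
rewrite !big_cons -IH//; apply: Af.1; first by apply: lin_span_gen; exact/FA/mem_head.
by exists F, c.
Qed.

Lemma functional_intmul f a (n : int) :
  cont_lin_functional (lin_span A) f -> A a -> f (a *~ n) = n%:~R * f a.
Proof.
move=> Af Aa; have := @functional_comb f [:: a] (fun=> n%:~R) Af.
rewrite !big_seq1 scaler_int; apply => b.
by rewrite inE => /eqP ->.
Qed.

Lemma functional_nbhs0 f (e : R) : cont_lin_functional (lin_span A) f -> 0 < e ->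
  nbhs (0 : E) [set v | lin_span A v -> `|f v| < e].
Proof.
move=> Af e0; have /subspace_continuousP/(_ _ (lin_span0 A)) := Af.2.
move=> /(_ (ball (f 0) e) (nbhsx_ballx _ _ e0)) near0.
have : nbhs (0 : E) [set v | lin_span A v -> ball (f 0) e (f v)] := near0.
apply: filterS => v /= fv Lv; move: (fv Lv).
by rewrite -ball_normE/= (functional0 Af) sub0r normrN.
Qed.

Context (indA : top_independent A) (weakA : topology_is_weak (lin_span A)).

Lemma weak_ball_nbhs0 (fs : seq (E -> R)) (e : R) : 0 < e ->
  (forall f, f \in fs -> cont_lin_functional (lin_span A) f) ->
  nbhs (0 : E) [set v | lin_span A v -> forall f, f \in fs -> `|f v| < e].
Proof.
move=> e0 Afs.
apply: (iffRL (weakA (lin_span0 A) [set v | forall f, f \in fs -> `|f v| < e])).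
exists fs, e; split => //; split => // v [_ fsv] f fsf.
by have := fsv _ fsf; rewrite (functional0 (Afs _ fsf)) subr0.
Qed.

(* If f did not vanish at more points than there are functionals defining the
   neighbourhood U, some real relation between those points would be killed by
   all these functionals; rounding large multiples of it to integers gives
   combinations in U with an arbitrarily large component at some a, f a != 0. *)
Lemma weak_finite_support f : cont_lin_functional (lin_span A) f ->
  finite_set [set a | A a /\ f a != 0].
Proof.
move=> Af; apply: contrapT => infA.
have [U U0 HU] := indA.2 _ (functional_nbhs0 Af ltr01).
have [|fs [eps [Afs [eps0 fsU]]]] := iffLR (weakA (lin_span0 A) U).
  by apply: filterS U0 => v.
have [B BA Bs] := infinite_set_fset (size fs).+1 infA.
pose F : seq E := finmap.enum_fset B.
have Fu : uniq F by exact: finmap.fset_uniq.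
have FA a : a \in F -> A a by move=> /BA[].
have [c [[a aF ca] cfs]] := linear_dependence Fu Bs.
have fa : 0 < `|f a| by rewrite normr_gt0; have /BA[] := aF.
have [e e0 He] := nbhs0_small_comb F (weak_ball_nbhs0 eps0 Afs).
(* The relation is rescaled to have coefficient [K] at [a]. Rounding [n%:R * K] with error below 1
   gives [z a] above [K - 1], the inverse of [|f a|], hence a component on which [f] exceeds 1. *)
pose K := 1 + `|f a|^-1.
have e10 : 0 < Num.min 1 e by rewrite lt_min ltr01.
have [_ /(_ (fun b => K / c a * c b))[n [z /andP[n0 _] Hz]]] :=
  simultaneous_approx F e10.
have : `|f (a *~ z a)| < 1.
  apply: (HU F z) => //; last first.
    by rewrite -scaler_int; apply: lin_spanZ; apply: lin_span_gen; exact: FA.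
  apply: fsU; split.
    exists F, (fun b => (z b)%:~R); split => //.
    by apply: eq_bigr => b _; rewrite scaler_int.
  move=> g gfs; rewrite (functional0 (Afs _ gfs)) subr0.
  pose d b := (z b)%:~R - n%:R * (K / c a * c b).
  have -> : \sum_(b <- F) b *~ z b = \sum_(b <- F) (z b)%:~R *: b.
    by apply: eq_bigr => b _; rewrite scaler_int.
  (* Since [g] kills the real relation, only the rounding errors [d] contribute. *)
  have -> : g (\sum_(b <- F) (z b)%:~R *: b) = g (\sum_(b <- F) d b *: b).
    rewrite !(functional_comb _ (Afs _ gfs))//.
    rewrite [RHS](eq_bigr (fun b => (z b)%:~R * g b - n%:R * (K / c a) * (c b * g b))).
      by rewrite sumrB -mulr_sumr cfs// mulr0 subr0.
    by move=> b _; rewrite /d; ring.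
  apply: He => //; last by exists F, d.
  by move=> b /Hz; rewrite distrC lt_min => /andP[].
rewrite (functional_intmul _ Af (FA _ aF)) normrM -ltr_pdivlMr// div1r.
have := Hz _ aF; rewrite divfK// lt_min ltr_norml => /andP[/andP[_ nKz] _].
have : K <= n%:R * K by rewrite ler_peMl ?ler1n// addr_ge0// invr_ge0 ltW.
have := ler_norm ((z a)%:~R : R); rewrite /K in nKz *; lra.
Qed.

(** The functionals defining a neighbourhood of the image are non-zero only on a finite part [S] of
    [A], so a box over [S] is mapped into it. *)
Lemma weak_dsum_map_continuous : {within dsum A, continuous (dsum_map A)}.
Proof.
apply/subspace_continuousP => h Ah U /nbhs_shift U0.
have [|fs [eps [Afs [eps0 fsU]]]] :=
  iffLR (weakA (lin_span0 A) [set v | U (dsum_map A h + v)]).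
  by apply: filterS U0 => v.
have [S SE] : exists S : seq E,
    forall g a, g \in fs -> A a -> g a != 0 -> a \in S.
  elim: fs Afs {fsU} => [|g fs IH] Afs; first by exists [::].
  have [|S HS] := IH; first by move=> f ffs; apply: Afs; rewrite inE ffs orbT.
  have /finite_seqP[S' S'E] := weak_finite_support (Afs g (mem_head _ _)).
  exists (S' ++ S) => f a; rewrite inE mem_cat => /orP[/eqP->|ffs] Aa fa.
    by have /= -> : [set` S'] a by rewrite -S'E.
  by rewrite (HS f)// orbT.
(* At most [size S] terms, each bounded by [d], will remain; the successor makes their sum strictly
   less than [eps]. *)
pose d := eps / (size S).+1%:R.
have d0 : 0 < d by rewrite divr_gt0.
have N0 := weak_ball_nbhs0 d0 Afs.
have box : nbhs h [set k : {ptws E -> E} | forall a, a \in S ->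
    lin_span A (k a - h a) -> forall f, f \in fs -> `|f (k a - h a)| < d].
  apply: (@nbhs_ptws_box _ _ h S (fun a => [set y : E | lin_span A (y - h a) ->
    forall f, f \in fs -> `|f (y - h a)| < d])) => a.
  apply/nbhs_shift; apply: filterS N0 => v /=.
  by rewrite [h a + v]addrC addrK.
near_simpl; rewrite /within/=; apply: filterS box => k Hk Ak.
suff : [set v | U (dsum_map A h + v)] (dsum_map A k - dsum_map A h).
  by rewrite /= addrC subrK.
have Akh := dsumB Ak Ah; rewrite -(dsum_mapB Ak Ah).
have [F [Fu FA khF]] := dsum_supp Akh; have [_ [khZ _]] := Akh.
have /choice[z Hz] a : exists n : int, A a -> k a - h a = a *~ n.
  by have [/khZ[n]|] := pselect (A a); [exists n | exists 0].
have khE : dsum_map A (fun x => k x - h x) = \sum_(a <- F) (z a)%:~R *: a.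
  rewrite (dsum_map_seq Akh Fu khF) !big_seq; apply: eq_bigr => a aF.
  by rewrite scaler_int Hz//; exact: FA.
apply: fsU; rewrite khE; split; first by exists F, (fun a => (z a)%:~R).
move=> f ffs; rewrite (functional0 (Afs _ ffs)) subr0.
rewrite (functional_comb _ (Afs _ ffs))// (bigID (mem S))/=.
rewrite [X in _ + X]big1_seq ?addr0; last first.
  move=> a /andP[aS aF]; have [->|fa] := eqVneq (f a) 0; first by rewrite mulr0.
  by rewrite (SE f)// in aS; exact: FA.
apply: (le_lt_trans (ler_norm_sum _ _ _)).
apply: (@le_lt_trans _ _ (\sum_(a <- F | a \in S) d)).
  rewrite big_seq_cond [leRHS]big_seq_cond; apply: ler_sum => a /andP[aF aS].
  rewrite -(functional_intmul _ (Afs _ ffs) (FA _ aF)) -Hz; last exact: FA.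
  apply/ltW/Hk => //; rewrite Hz; last exact: FA.
  by rewrite -scaler_int; apply: lin_spanZ; apply: lin_span_gen; exact: FA.
rewrite big_const_seq iter_addr_0 -size_filter.
have : (size [seq a <- F | a \in S] <= size S)%N.
  apply: uniq_leq_size; first exact: filter_uniq.
  by move=> a; rewrite mem_filter => /andP[].
move=> szS; rewrite -mulr_natr /d -mulrA gtr_pMr// mulrC ltr_pdivrMr//.
by rewrite mul1r ltr_nat ltnS.
Qed.

End Functionals.

(** * Coordinates along [A] when summation is continuous *)

Section Coordinates.
Context (R : realType) (E : topologicalLmodType R).
Context (A : set E).
Context (hausE : hausdorff_space E) (indA : top_independent A)
  (ctsA : {within dsum A, continuous (dsum_map A)}).
Implicit Types U V W : set E.

(** By continuity of summation at 0 and [nbhs_ptws], families vanishing on some finite [F0] have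
    their sum in [U]. *)
Lemma cofinite_subgroup U : nbhs (0 : E) U -> exists F0 : seq E,
  forall (F : seq E) (z : E -> int), (forall a, a \in F -> A a /\ a \notin F0) ->
  U (\sum_(a <- F) a *~ z a).
Proof.
move=> U0; have /subspace_continuousP/(_ _ (dsum0 A)) := ctsA.
have {}U0 : nbhs (dsum_map A (fun=> 0)) U by rewrite dsum_map0.
move=> /(_ U U0) near0.
have [F0 HF0] := nbhs_ptws (near0 : nbhs ((fun=> 0) : {ptws E -> E})
  [set g : {ptws E -> E} | dsum A g -> U (dsum_map A g)]).
exists F0 => F z FA.
have [|g [Ag <- gF]] := @gen_dsum _ _ A F z; first by move=> a /FA[].
apply: HF0 => // a aF0; apply: gF; apply/negP => /FA[_].
by rewrite aF0.
Qed.

(* For large N, (1/N) sum_b floor(N c_b) b is close to sum_b c_b b. *)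
Lemma cofinite_span U : nbhs (0 : E) U -> exists F0 : seq E,
  forall x, lin_span (A `\` [set` F0]) x -> U x.
Proof.
(* One summand in [V] takes the integer combination divided by [N], the other the rounding error. *)
move=> U0; have [V [V0 _ Vb VU]] := balanced_nbhs0_add U0.
have [F0 HF0] := cofinite_subgroup V0.
exists F0 => _ [F [c [FA ->]]].
have [e e0 He] := nbhs0_small_comb F V0.
pose N := (Num.truncn e^-1).+1.
have NR : 0 < N%:R :> R by rewrite ltr0n.
have eN : N%:R^-1 < e by rewrite invf_plt ?posrE// truncnS_gt.
pose z a := Num.floor (N%:R * c a).
have -> : \sum_(a <- F) c a *: a = N%:R^-1 *: (\sum_(a <- F) a *~ z a) +
    \sum_(a <- F) (c a - N%:R^-1 * (z a)%:~R) *: a.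
  rewrite scaler_sumr -big_split; apply: eq_bigr => a _ /=.
  by rewrite -scaler_int scalerA -scalerDl addrC subrK.
apply: VU; last first.
  apply: He => a _; apply: le_lt_trans eN.
  have -> : c a - N%:R^-1 * (z a)%:~R = N%:R^-1 * (N%:R * c a - (z a)%:~R).
    by rewrite mulrBr mulKf// gt_eqF.
  rewrite ger0_norm; last first.
    by rewrite mulr_ge0 ?invr_ge0 ?(ltW NR)// subr_ge0 floor_le.
  rewrite ler_piMr ?invr_ge0 ?(ltW NR)//.
  by have := floorD1_gt (N%:R * c a); rewrite intrD1 -/(z a); lra.
apply: Vb; first by rewrite ger0_norm ?invr_ge0 ?(ltW NR)// invf_le1// ler1n.
by apply: HF0 => a /FA[Aa /negP].
Qed.

(* Modulo the small subspace spanned by the vectors outside a finite set F, only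
   the coefficients on F matter. If |r| >= 1, Dirichlet's theorem gives a multiple
   n, bounded independently of the vector, whose coefficients on F are almost
   integers, that of a being nonzero; this contradicts independence. *)
Lemma coord_bounded a : A a -> exists2 U : set E, nbhs (0 : E) U &
  forall r y, lin_span (A `\ a) y -> U (r *: a + y) -> `|r| < 1.
Proof.
move=> Aa; have a0 : a != 0 by apply/eqP => a0; apply: indA.1; rewrite -a0.
have [W' W'0 W'a] := hausdorff_nbhs0 hausE a0.
(* Being balanced and missing [a], [W] misses all non-zero integer multiples of [a]. *)
have [W [W0 WW' Wb]] := nbhs0_balanced W'0.
have [U1 U10 HU1] := indA.2 _ W0.
have [U2 [U20 _ _ U2D]] := balanced_nbhs0_add U10.
have [V [V0 VU2 Vb VD]] := balanced_nbhs0_add U20.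
have [F0 HF0] := cofinite_span V0.
pose F' := undup [seq b <- F0 | `[< A b /\ b != a >]].
have F'E b : (b \in F') = `[< A b /\ b != a >] && (b \in F0).
  by rewrite mem_undup mem_filter.
have aF' : a \notin F' by rewrite F'E negb_and asboolF// eqxx => -[].
have Fu : uniq (a :: F') by rewrite /= aF' undup_uniq.
have FA b : b \in a :: F' -> A b.
  by rewrite inE F'E => /orP[/eqP->//|/andP[/asboolP[]]].
have [e e0 He] := nbhs0_small_comb (a :: F') V0.
have e10 : 0 < Num.min 1 e by rewrite lt_min ltr01.
have [N HN] := simultaneous_approx (a :: F') e10.
(* With [n <= N] and [|r| >= 1], balancedness then puts the multiple by [n%:R / r] in [V]. *)
exists [set x | V (N%:R *: x)]; first exact: nbhs0_scale.
move=> r y Ay Vx; rewrite ltNge; apply/negP => r1.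
have r0 : r != 0 by rewrite -normr_gt0 (lt_le_trans ltr01).
have [c cy] := lin_spanDseq (undup_uniq _ : uniq F') Ay.
set y' := y - _ in cy.
have yE : y = y' + \sum_(b <- F') c b *: b by rewrite subrK.
(* Division by [r] normalises the coefficient of [a] to 1, so [z a] is within distance 1 of [n > 0]
   and cannot vanish. *)
pose d b := if b == a then 1 else c b / r.
have [n [z /andP[n0 nN] Hz]] := HN d.
have Wz : W (a *~ z a).
  apply: (HU1 (a :: F') z Fu FA) => //; last exact: mem_head.
  have -> : \sum_(b <- a :: F') b *~ z b =
      ((n%:R / r) *: (r *: a + y) + - (n%:R / r) *: y') +
      \sum_(b <- a :: F') ((z b)%:~R - n%:R * d b) *: b.
    have -> : (n%:R / r) *: (r *: a + y) + - (n%:R / r) *: y' =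
        \sum_(b <- a :: F') (n%:R * d b) *: b.
      rewrite scaleNr -scalerBr yE [y' + _]addrC addrA addrK big_cons /d eqxx.
      rewrite scalerDr scalerA divfK// mulr1 scaler_sumr; congr (_ + _).
      rewrite !big_seq; apply: eq_bigr => b bF'.
      case: eqVneq bF' aF' => [->->//|_ _ _].
      by rewrite scalerA; congr (_ *: _); rewrite mulrAC mulrA.
    rewrite -big_split; apply: eq_bigr => b _ /=.
    by rewrite -scalerDl addrC subrK scaler_int.
  apply: U2D; last first.
    by apply/VU2/He => b /Hz; rewrite distrC lt_min => /andP[].
  apply: VD.
    have N0 : N%:R != 0 :> R by rewrite pnatr_eq0 -lt0n (leq_trans n0).
    have -> : (n%:R / r) *: (r *: a + y) =
        (n%:R / r / N%:R) *: (N%:R *: (r *: a + y)).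
      by rewrite [RHS]scalerA divfK.
    apply: Vb => //; rewrite !normrM !normfV !normr_nat -!mulrA -invfM.
    rewrite ler_pdivrMr ?mul1r.
      apply: (@le_trans _ _ N%:R); first by rewrite ler_nat.
      by rewrite ler_peMl.
    by rewrite mulr_gt0 ?normr_gt0// ltr0n (leq_trans n0).
  apply/HF0/lin_spanZ; apply: lin_spanS cy => b [[Ab ba] bF']; split => // bF0.
  by apply: bF'; rewrite /= F'E bF0 andbT; apply/asboolP; split => //; exact/eqP.
have za : z a != 0.
  apply/eqP => za; have := Hz _ (mem_head _ _).
  rewrite /d eqxx za mulr1 subr0 normr_nat lt_min => /andP[+ _].
  by rewrite ltNge ler1n n0.
apply: W'a; apply: WW'.
have -> : a = (z a)%:~R^-1 *: (a *~ z a).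
  by rewrite -[a *~ z a]scaler_int scalerA mulVf ?scale1r// intr_eq0.
apply: Wb => //; rewrite normfV invf_le1 ?normr_gt0 ?intr_eq0//.
by rewrite -intr_norm ler1z -gtz0_ge1 normr_gt0.
Qed.

(** Otherwise [- a] lies in the span of the other vectors, and [1 *: a - a = 0], a member of every
    neighbourhood of 0, contradicts the bound [|1| < 1]. *)
Lemma lin_span_indep a (r : R) : A a -> lin_span (A `\ a) (r *: a) -> r = 0.
Proof.
move=> Aa Ara; apply/eqP/negPn/negP => r0.
have [U U0 HU] := coord_bounded Aa.
have := HU 1 (- a); rewrite scale1r subrr normr1 ltxx.
have -> : - a = (- r^-1) *: (r *: a).
  by rewrite scaleNr scalerA mulVf// scale1r.
move=> H; have : false = true by apply: H; [exact: lin_spanZ | exact: nbhs_singleton].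
by [].
Qed.

(** Uniqueness of the coefficient of [a] gives linearity, and rescaling [coord_bounded] gives
    continuity. *)
Lemma coord_functional a : A a -> exists2 f : E -> R,
  cont_lin_functional (lin_span A) f &
  forall x, lin_span A x -> lin_span (A `\ a) (x - f x *: a).
Proof.
move=> Aa.
have /choice[f Hf] x : exists r : R, lin_span A x -> lin_span (A `\ a) (x - r *: a).
  by have [/(lin_spanD1 a)[r]|] := pselect (lin_span A x); [exists r | exists 0].
have flin r x y : lin_span A x -> lin_span A y -> f (r *: x + y) = r * f x + f y.
  move=> Ax Ay; apply/eqP; rewrite eq_sym -subr_eq0; apply/eqP.
  apply: (lin_span_indep Aa).
  (* The defect of linearity times [a] is a combination of remainders, all in the span without
     [a]. *)
  have -> : (r * f x + f y - f (r *: x + y)) *: a =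
      (r *: x + y - f (r *: x + y) *: a) -
      (r *: (x - f x *: a) + (y - f y *: a)).
    rewrite scalerBl scalerDl -scalerA scalerBr (addrACA (r *: x)) -opprD opprB.
    by rewrite [RHS]addrC subrKA.
  apply: lin_spanB; first by apply: Hf; apply: lin_spanD => //; exact: lin_spanZ.
  by apply: lin_spanD; [apply: lin_spanZ|]; exact: Hf.
exists f => //; split => //; apply/subspace_continuousP => x Ax B.
move=> /nbhs_ballP[d /= d0 dB].
have [U U0 HU] := coord_bounded Aa.
have Ux : nbhs x [set y | U (d^-1 *: (y - x))].
  apply/nbhs_shift; apply: filterS (nbhs0_scale d^-1 U0) => v /=.
  by rewrite [x + v]addrC addrK.
near_simpl; rewrite /within/=; apply: filterS Ux => y /= Uyx Ay.
apply: dB; rewrite -ball_normE/=.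
have Axy : lin_span A (y - x) by exact: lin_spanB.
have -> : f x - f y = - f (y - x).
  have -> : y - x = -1 *: x + y by rewrite scaleN1r addrC.
  by rewrite flin// mulN1r opprD opprK.
have := HU (d^-1 * f (y - x)) (d^-1 *: ((y - x) - f (y - x) *: a)).
rewrite -scalerA -scalerDr [_ *: a + _]addrC subrK => /(_ (lin_spanZ _ (Hf _ Axy)) Uyx).
by rewrite normrN normrM ger0_norm ?invr_ge0 ?ltW// mulrC ltr_pdivrMr// mul1r.
Qed.

Lemma dsum_map_continuous_weak : topology_is_weak (lin_span A).
Proof.
have /choice[e He] a : exists f : E -> R, A a ->
    cont_lin_functional (lin_span A) f /\
    forall x, lin_span A x -> lin_span (A `\ a) (x - f x *: a).
  have [/coord_functional[f Af Hf]|] := pselect (A a); last by exists (fun=> 0).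
  by exists f.
move=> x Ax U; split => [Ux|[fs [eps [Afs [eps0 fsU]]]]]; last first.
  (* A weak neighbourhood is a finite intersection of preimages under continuous functionals. *)
  suff : nbhs x [set y | lin_span A y -> forall f, f \in fs -> `|f y - f x| < eps].
    by apply: filterS => y Hy Ay; apply: fsU; split => //; exact: Hy.
  elim: fs Afs {fsU} => [|f fs IH] Afs; first by apply: filterS filterT => y _ _ f.
  have [|_ /subspace_continuousP/(_ _ Ax)] := Afs f; first exact: mem_head.
  move=> /(_ (ball (f x) eps) (nbhsx_ballx _ _ eps0)) fx.
  have {}fx : nbhs x [set y | lin_span A y -> ball (f x) eps (f y)] := fx.
  have {}IH : nbhs x [set y | lin_span A y ->
      forall f, f \in fs -> `|f y - f x| < eps].
    by apply: IH => g gfs; apply: Afs; rewrite inE gfs orbT.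
  apply: filterS (filterI fx IH) => y [fy fsy] Ay g.
  rewrite inE => /orP[/eqP->|]; last exact: fsy.
  by have := fy Ay; rewrite -ball_normE/= distrC.
have {Ux}/nbhs_shift U0 : nbhs x [set y | lin_span A y -> U y] := Ux.
have [V V0 VD] := nbhs0_add U0.
have [F0 HF0] := cofinite_span V0.
pose F := undup [seq b <- F0 | `[< A b >]].
have FE b : (b \in F) = `[< A b >] && (b \in F0) by rewrite mem_undup mem_filter.
have FA b : b \in F -> A b by rewrite FE => /andP[/asboolP].
have [eps eps0 Heps] := nbhs0_small_comb F V0.
exists [seq e b | b <- F], eps; split.
  by move=> f /mapP[b /FA Ab ->]; have [] := He _ Ab.
split => // y [Ay Hy].
have Ayx : lin_span A (y - x) by exact: lin_spanB.
suff : lin_span A (x + (y - x)) -> U (x + (y - x)).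
  by rewrite addrC subrK; apply.
have eB b : b \in F -> e b (y - x) = e b y - e b x.
  move=> /FA/He[[elin _] _].
  have -> : y - x = -1 *: x + y by rewrite scaleN1r addrC.
  by rewrite elin// mulN1r addrC.
have [c cyx] := lin_spanDseq (undup_uniq _ : uniq F) Ayx.
(* The coefficient [c b] and the coordinate [e b (y - x)] both leave a remainder in the span without
   [b], so they agree by [lin_span_indep]. *)
have cE b : b \in F -> c b = e b (y - x).
  move=> bF; have Ab := FA _ bF; have [_ /(_ _ Ayx) eyx] := He _ Ab.
  apply/eqP; rewrite -subr_eq0; apply/eqP/(lin_span_indep Ab).
  have -> : (c b - e b (y - x)) *: b = ((y - x) - e b (y - x) *: b) -
      ((y - x - \sum_(b <- F) c b *: b) +
       \sum_(b' <- F | b' != b) c b' *: b').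
    rewrite [in X in _ - (X + _)](bigD1_seq b bF (undup_uniq _))/=.
    by rewrite (opprD (c b *: b)) addrA subrK opprB [RHS]addrC subrKA scalerBl.
  apply: lin_spanB => //; apply: lin_spanD.
    apply: lin_spanS cyx => b' [Ab' b'F]; split => //= b'b; apply: b'F.
    by rewrite /= b'b.
  rewrite -big_filter; exists [seq b' <- F | b' != b], c; split => // b'.
  by rewrite mem_filter => /andP[/eqP b'b /FA].
rewrite -[y - x](subrK (\sum_(b <- F) c b *: b)); apply: VD.
  apply: HF0; apply: lin_spanS cyx => b [Ab bF]; split => //= bF0.
  by apply: bF; rewrite /= FE bF0 andbT; exact/asboolP.
apply: Heps => b bF; rewrite cE// eB//; apply: Hy.
exact: map_f.
Qed.

End Coordinates.

Theorem theorem2p9 (R : realType) (E : topologicalLmodType R) (A : set E) :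
  hausdorff_space E -> top_independent A ->
  (is_tychonoff_dsum A <-> topology_is_weak (lin_span A)).
Proof.
move=> hausE indA; split=> [[_ [_ [ctsA _]]]|weakA].
  exact: dsum_map_continuous_weak.
by apply: is_tychonoff_dsum_continuous => //; exact: weak_dsum_map_continuous.
Qed.
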